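(* Let $Q>0$ and $\Theta$ be independent random elements. Suppose, for $a>0$, $\rho>0$ and $b\in\mathbb R$, $$\Pr(Q>q)=a q^{-1}\{1-bq^{-\rho}+r_Q(q)\},\qquad r_Q(q)=o(q^{-\rho})\quad(q\to\infty).$$ Let $S(q,\Theta)$ be a nonnegative statistic. For some finite collection $\lambda_1,\dots,\lambda_J>0$, suppose its large-$q$ expansion is $$S(q,\Theta)=qA(\Theta)\Big\{1+\sum_{j=1}^Jc_j(\Theta)q^{-\lambda_j}+r_S(q,\Theta)\Big\},$$ with $A\ge0$ and $r_S$ the remainder. Put $\delta=\min\{\rho,\lambda_1,\dots,\lambda_J\}$. For large $t$, assume that the upper tail event can be written $$\{S(Q,\Theta)>t\}=\{Q>q_t(\Theta)\}$$ up to an event of probability $o(t^{-1-\delta})$, where $q_t\to\infty$ (as $t\to\infty$) almost surely on $\{A>0\}$, and set $q_t=\infty$ on $\{A=0\}$. Assume $$\mathbb E\Big|q_t^{-1}-\frac At-\sum_{j:\lambda_j=\delta}c_jA^{1+\delta}t^{-1-\delta}\Big|=o(t^{-1-\delta}),$$ $$\mathbb E(q_t^{-1-\rho})=t^{-1-\rho}\,\mathbb E(A^{1+\rho})+o(t^{-1-\delta}),$$ $$\mathbb E\{q_t^{-1}|r_Q(q_t)|\}=o(t^{-1-\delta}).$$ Then, as $t\to\infty$, $$\Pr\{S(Q,\Theta)>t\}=\frac{a\,\mathbb EA}{t}+K_\delta t^{-1-\delta}+o(t^{-1-\delta}),$$ where $$K_\delta=a\sum_{j:\lambda_j=\delta}\mathbb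 E(c_jA^{1+\delta})-a\,\mathbf 1\{\rho=\delta\}\,b\,\mathbb E(A^{1+\delta}).$$
   Context: $A=A(\Theta)$, $c_j=c_j(\Theta)$ and $q_t=q_t(\Theta)$ are measurable functions of $\Theta$. Any product containing $A$ is defined to be zero on $\{A=0\}$, and $q_t^{-1}=0$ (and the terms $q_t^{-1-\rho}$, $q_t^{-1}|r_Q(q_t)|$ are zero) where $q_t=\infty$. The function $r_Q$ is defined for all $q>0$ by the displayed tail formula. *)

(* Defs.v *)
From mathcomp Require Export all_boot all_order all_algebra.
From mathcomp Require Export all_classical all_reals all_analysis.
From mathcomp Require Export measurable_realfun.
Export Order.TTheory GRing.Theory Num.Theory.
Export numFieldNormedType.Exports.

Set Implicit Arguments.
Unset Strict Implicit.
Unset Printing Implicit Defensive.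

Local Open Scope classical_set_scope.
Local Open Scope ring_scope.

Definition independent_elements d d1 d2 (Omega : measurableType d)
    (T1 : measurableType d1) (T2 : measurableType d2) (R : realType)
    (P : probability Omega R) (X : {RV P >-> T1}) (Y : {RV P >-> T2}) : Prop :=
  forall (B1 : set T1) (B2 : set T2), measurable B1 -> measurable B2 ->
    P ((X @^-1` B1) `&` (Y @^-1` B2)) = (P (X @^-1` B1) * P (Y @^-1` B2))%E.

(* Lets the Landau notations be used at +oo. *)
Canonical pinfty_filter_on (R : realType) :=
  FilterType (pinfty_nbhs R) (@proper_pinfty_nbhs R).

(* f t = o(g t) as t -> +oo for an extended-real f, which must be eventually
   finite.  Since +oo - +oo is not a finite number, [ereal_littleo (X - Y) g]
   forces both X and Y to be eventually finite. *)
Definition ereal_littleo (R : realType) (f : R -> \bar R) (g : R -> R) : Prop :=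
  (\forall t \near +oo, f t \is a fin_num) /\
  ((fun t => fine (f t)) : R -> R) =o_ (pinfty_nbhs R) g.

(* f(x) for finite x, and 0 at x = +oo: the convention for the expressions
   q_t^-1, q_t^(-1-rho) and q_t^-1 |r_Q(q_t)| where q_t = +oo.  The library's
   own extended power is not suitable, as it sends +oo to +oo even when the
   exponent is negative. *)
Definition zero_at_oo (R : realType) (f : R -> R) (x : \bar R) : R :=
  if x is r%:E then f r else 0.

Definition min_exponent (R : realType) (rho : R) (J : nat) (lam : 'I_J -> R) : R :=
  \big[Num.min/rho]_(j < J) lam j.

(* c A^s as a random variable.  For s > 0 the library's 0 `^ s is 0, so this
   product vanishes on {A = 0} whatever the value of c there. *)
Definition coefA d' (Omega : Type) (T : measurableType d') (R : realType)
    (Theta : Omega -> T) (A c : T -> R) (s : R) : Omega -> R :=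
  fun w => c (Theta w) * A (Theta w) `^ s.

Definition K_coef d d' (Omega : measurableType d) (T : measurableType d')
    (R : realType) (P : probability Omega R) (Theta : {RV P >-> T})
    (A : T -> R) (J : nat) (c : 'I_J -> T -> R) (lam : 'I_J -> R)
    (a b rho : R) : \bar R :=
  let delta := min_exponent rho lam in
  (a%:E * (\sum_(j < J | lam j == delta)
             'E_P[coefA Theta A (c j) (1 + delta)%R])
   - (a * (rho == delta)%:R * b)%:E
       * 'E_P[fun w => (A (Theta w) `^ (1 + delta))%R])%E.
Arguments K_coef {d d' Omega T R} P Theta A {J} c lam a b rho.

(* Main.v *)
From HB Require Import structures.
Require Import Defs.
From mathcomp Require Import ring lra.

Set Implicit Arguments.
Unset Strict Implicit.
Unset Printing Implicit Defensive.

Local Open Scope classical_set_scope.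
Local Open Scope ring_scope.

(* By independence, P(q_t(Theta) < Q) is the expectation of the tail function of
   Q at q_t(Theta), that is
   a E[q_t^-1] - a b E[q_t^(-1-rho)] + a E[q_t^-1 r_Q(q_t)].
   The hypotheses give each of the three expectations up to o(t^(-1-delta)); the
   A^(1+rho) term is itself negligible unless rho = delta. All integrability
   comes from the finiteness built into the hypotheses: that of E[q_t^(-1-rho)]
   and of E[A^(1+rho)] yields that of q_t^-1 and A, whence that of the
   coefficient of t^(-1-delta) by difference; hint is needed only to split that
   coefficient into its summands. *)

(** * Landau symbols and real powers at infinity *)

Lemma eqo_le (R : realType) (f g h : R -> R) :
  (\forall t \near +oo, `|f t| <= `|h t|) ->
  h =o_ (pinfty_nbhs R) g -> f =o_ (pinfty_nbhs R) g.
Proof.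
move=> fh /eqoP hg; apply/eqoP => e e0.
by have := hg _ e0; apply: filterS2 fh => t; exact: le_trans.
Qed.

Lemma eqoMl (R : realType) (k : R) (f g : R -> R) :
  f =o_ (pinfty_nbhs R) g -> (fun t => k * f t) =o_ (pinfty_nbhs R) g.
Proof.
move=> /eqoP fg; apply/eqoP => e e0.
(* Adding 1 keeps the divisor positive even when [k] is 0. *)
have k0 : 0 < `|k| + 1 by rewrite ltr_wpDl.
have := fg _ (divr_gt0 e0 k0); apply: filterS => t ft.
rewrite normrM (le_trans (ler_wpM2l (normr_ge0 k) ft))// mulrA ler_wpM2r//.
by rewrite mulrCA ger_pMr// ler_pdivrMr// mul1r lerDl.
Qed.

Lemma powR_eqo (R : realType) (r s : R) : r < s ->
  (fun t => t `^ r) =o_ (pinfty_nbhs R) (fun t => t `^ s).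
Proof.
move=> rs; apply/eqoP => e e0.
have sr0 : 0 < s - r by rewrite subr_gt0.
near=> t.
have t0 : 0 < t by near: t; exact: nbhs_pinfty_gt.
rewrite !ger0_norm ?powR_ge0// -[s](subrK r) powRD ?(gt_eqF t0) ?implybT//.
rewrite mulrA ler_peMl ?powR_ge0// -ler_pdivrMl// mulr1.
(* The inequality has been reduced to e^-1 <= t^(s - r), which holds once t is at least the (s -
   r)-th root of e^-1. *)
have <- : (e^-1 `^ ((s - r)^-1)) `^ (s - r) = e^-1.
  by rewrite -powRrM mulVf ?gt_eqF// powRr1// invr_ge0 ltW.
by apply: ge0_ler_powR; rewrite ?nnegrE ?powR_ge0 ?ltW//.
Unshelve. all: by end_near. Qed.

(** For x >= 1 powers increase with the exponent, and for x < 1 the left side is at most 1. This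
    lets integrability of a high power pass to lower ones on a probability space. *)
Lemma powR_le1D (R : realType) (x r s : R) : 0 <= x -> 0 <= r -> r <= s ->
  x `^ r <= 1 + x `^ s.
Proof.
move=> x0 r0 rs; have [x1|/ltW x1] := leP 1 x.
  by rewrite (le_trans (ler_powR x1 rs))// lerDr.
rewrite (@le_trans _ _ 1)// ?lerDl ?powR_ge0//.
by rewrite (le_trans (ge0_ler_powR r0 _ _ x1)) ?powR1// nnegrE.
Qed.

(** * Measurability, integrability and real-valued expectations *)

Lemma measurable_zero_at_oo (R : realType) (f : R -> R) :
  measurable_fun setT f -> measurable_fun setT (zero_at_oo f).
Proof.
move=> mf.
have -> : zero_at_oo f = fun y => if y \is a fin_num then f (fine y) else 0.
  by apply/funext => -[].
apply: measurable_fun_ifT => //; last exact: measurableT_comp.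
apply: (measurable_fun_bool true) => //.
exact: emeasurable_fin_num.
Qed.

Section expectation.
Context d (Omega : measurableType d) (R : realType) (P : probability Omega R).
Local Notation int f := (P.-integrable setT (EFin \o f)).

Lemma expectation_Rintegral (f : Omega -> R) : int f ->
  ('E_P[f] = (\int[P]_w f w)%:E)%E.
Proof. by move=> fi; rewrite unlock fineK// integrable_fin_num. Qed.

(** In the extended reals +oo - +oo is infinite, so a finite integral forces both the positive and
    the negative part to have finite integral. *)
Lemma fin_expectation (f : Omega -> R) : measurable_fun setT f ->
  'E_P[f]%E \is a fin_num -> int f.
Proof.
move=> mf; rewrite unlock -integral_fin_num_abs// => foo.
by apply/integrableP; split => //; exact/measurable_EFinP.
Qed.

Lemma integrableRD (f g : Omega -> R) : int f -> int g ->
  int (fun w => f w + g w).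
Proof. by move=> fi gi; exact: (integrableD measurableT fi gi). Qed.

Lemma integrableRB (f g : Omega -> R) : int f -> int g ->
  int (fun w => f w - g w).
Proof. by move=> fi gi; exact: (integrableB measurableT fi gi). Qed.

Lemma integrableRZl (k : R) (f : Omega -> R) : int f -> int (fun w => k * f w).
Proof. by move=> fi; exact: (integrableZl measurableT k fi). Qed.

Lemma integrable_Rsum I (s : seq I) (p : pred I) (f : I -> Omega -> R) :
  (forall i, p i -> int (f i)) -> int (fun w => \sum_(i <- s | p i) f i w).
Proof.
move=> fi; have := integrable_sum measurableT s fi.
by apply: eq_integrable => // w _; rewrite /= sumEFin.
Qed.

Lemma Rintegral_sum I (s : seq I) (p : pred I) (f : I -> Omega -> R) :
  (forall i, p i -> int (f i)) ->
  \int[P]_w (\sum_(i <- s | p i) f i w) = \sum_(i <- s | p i) \int[P]_w f i w.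
Proof.
move=> fi; elim: s => [|i s IH].
  by under eq_Rintegral do rewrite big_nil; rewrite big_nil Rintegral_cst// mul0r.
under eq_Rintegral do rewrite big_cons; rewrite big_cons.
case: ifPn => // pi; rewrite RintegralD// ?IH//; first exact: fi.
exact: integrable_Rsum.
Qed.

Lemma integrable_le1D (f g : Omega -> R) : measurable_fun setT f ->
  (forall w, 0 <= f w <= 1 + g w) -> int g -> int f.
Proof.
move=> mf fg gi.
have : int (fun w => 1 + g w).
  by apply: integrableRD => //; exact: finite_measure_integrable_cst.
apply: le_integrable => //; first exact/measurable_EFinP.
move=> w _ /=; rewrite lee_fin; have /andP[f0 f1] := fg w.
by rewrite !ger0_norm// (le_trans f0).
Qed.

End expectation.

(** * Independence as a product law *)

Section independence.
Context d d1 d2 (Omega : measurableType d) (T1 : measurableType d1)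
  (T2 : measurableType d2) (R : realType) (P : probability Omega R)
  (X : {RV P >-> T1}) (Y : {RV P >-> T2}).
Hypothesis XY : independent_elements X Y.
Local Open Scope ereal_scope.

(** Independence says that the law of [(Y, X)] agrees with the product of the two laws on
    rectangles, hence on every measurable set. The product measure of [B] is the integral of the
    measures of its sections. *)
Lemma independent_xsection (B : set (T2 * T1)) : measurable B ->
  P [set w | B (Y w, X w)] =
    \int[P]_w P [set w' | B (Y w, X w')].
Proof.
move=> mB.
have mYX : measurable_fun setT (fun w => (Y w, X w)).
  exact: measurable_fun_pair.
pose YX : {mfun Omega >-> (T2 * T1)%type} :=
  HB.pack (fun w => (Y w, X w)) (isMeasurableFun.Build _ _ _ _ _ mYX).
rewrite -[LHS]/(distribution P YX B).
have <- := @product_measure_unique _ _ _ _ _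
  (distribution P Y) (distribution P X) (distribution P YX) _ B mB.
- rewrite /product_measure1 /= ge0_integral_distribution//.
  - apply: eq_integral => w _ /=; rewrite /distribution /pushforward.
    by congr (P _); apply/seteqP; split => w' /=; rewrite /xsection/= inE.
  - exact: (measurable_fun_xsection (distribution P X) mB).
- move=> B2 B1 mB2 mB1; rewrite /distribution /pushforward /=.
  rewrite muleC -XY//; congr (P _).
  by apply/seteqP; split => w /= [].
Qed.

End independence.

(** * Exact formula for the probability that [Q] exceeds a random threshold *)

Section tail_expansion.
Context d d' (Omega : measurableType d) (T : measurableType d') (R : realType)
  (P : probability Omega R) (Q : {RV P >-> R}) (Theta : {RV P >-> T}).
Hypothesis indQT : independent_elements Q Theta.
Variables (a b rho : R) (rQ : R -> R).
Hypothesis a_gt0 : 0 < a.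
Hypothesis tailQ : forall x : R, 0 < x ->
  P [set w | x < Q w] = (a * x^-1 * (1 - b * x `^ (- rho) + rQ x))%:E.
Variable y : T -> \bar R.
Hypothesis measurable_y : measurable_fun setT y.
Hypothesis y_gt0 : forall theta, (0 < y theta)%E.
Local Notation int f := (P.-integrable setT (EFin \o f)).
Let U w := zero_at_oo (fun x => x^-1) (y (Theta w)).
Let V w := zero_at_oo (fun x => x `^ (- 1 - rho)) (y (Theta w)).
Let W w := zero_at_oo (fun x => x^-1 * rQ x) (y (Theta w)).
Let G theta := P [set w | (y theta < (Q w)%:E)%E].

Lemma measurable_tail_event :
  measurable [set w | (y (Theta w) < (Q w)%:E)%E].
Proof.
rewrite -[X in measurable X]setTI; apply: measurable_lte => //.
- exact: measurableT_comp.
- exact/measurable_EFinP.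
Qed.

Let measurable_tail_section theta :
  measurable [set w | (y theta < (Q w)%:E)%E].
Proof.
rewrite -[X in measurable X]setTI; apply: measurable_lte => //.
exact/measurable_EFinP.
Qed.

Let measurable_tail_set : measurable [set p : T * R | (y p.1 < p.2%:E)%E].
Proof.
rewrite -[X in measurable X]setTI; apply: measurable_lte => //.
- exact: measurableT_comp.
- exact/measurable_EFinP.
Qed.

(** At a finite threshold this is [tailQ] expanded; at +oo the event is empty because [Q] is
    real-valued, and the three terms vanish by the convention of [zero_at_oo]. Positivity excludes
    -oo. *)
Lemma tail_zero_at_oo w :
  fine (G (Theta w)) = a * U w - a * b * V w + a * W w.
Proof.
rewrite /G /U /V /W; have := y_gt0 (Theta w).
case: (y (Theta w)) => [x| |]//=.
  rewrite lte_fin => x0; under eq_set do rewrite lte_fin.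
  rewrite tailQ//= powRD ?(gt_eqF x0) ?implybT//.
  by rewrite powR_inv1 ?ltW//; ring.
move=> _; rewrite (_ : [set _ | _] = set0) ?measure0/=; last first.
  by apply/seteqP; split => // w'/=; rewrite ltNge leey.
by rewrite !mulr0 subr0 addr0.
Qed.

Let measurable_G : measurable_fun setT (fine \o G).
Proof.
apply: measurableT_comp => //.
have := measurable_fun_xsection (distribution P Q) measurable_tail_set.
apply: eq_measurable_fun => theta _ /=.
by rewrite /distribution /pushforward /G; congr (P _);
  apply/seteqP; split => w /=; rewrite /xsection/= inE.
Qed.

Let integrable_G : int (fine \o G \o Theta).
Proof.
(* With the zero function as [g], the dominating function is the constant 1. *)
apply: (@integrable_le1D _ _ _ _ _ (cst 0)).
- exact: measurableT_comp.
- move=> w /=; rewrite addr0 fine_ge0//= -lee_fin fineK ?fin_num_measure//.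
  exact: probability_le1.
- exact: finite_measure_integrable_cst.
Qed.

Lemma measurable_zero_at_oo_powR r :
  measurable_fun setT (fun w => zero_at_oo (fun x => x `^ r) (y (Theta w))).
Proof.
apply: measurableT_comp => //.
  by apply: measurable_zero_at_oo; exact: measurable_powR.
exact: measurableT_comp.
Qed.

Lemma zero_at_oo_invE w : U w = zero_at_oo (fun x => x `^ (-1)) (y (Theta w)).
Proof.
rewrite /U; have := y_gt0 (Theta w); case: (y (Theta w)) => //= r.
by rewrite lte_fin => r0; rewrite powR_inv1// ltW.
Qed.

Hypothesis rho_gt0 : 0 < rho.
Hypothesis V_fin : 'E_P[V]%E \is a fin_num.

Let integrable_V : int V.
Proof. exact: fin_expectation (measurable_zero_at_oo_powR _) V_fin. Qed.

(** With z = 1/x, the bound z <= 1 + z^(1 + rho) gives U <= 1 + V pointwise. *)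
Lemma integrable_zero_at_oo_inv : int U.
Proof.
apply: integrable_le1D integrable_V.
  by apply: eq_measurable_fun (measurable_zero_at_oo_powR (-1)) => w _;
    rewrite zero_at_oo_invE.
move=> w; rewrite /U /V; have := y_gt0 (Theta w).
case: (y (Theta w)) => [x| |]//=; rewrite ?addr0 ?lexx ?ler01// lte_fin => x0.
have V0 : 0 <= x^-1 by rewrite invr_ge0 ltW.
rewrite V0/= -{1}(powRr1 V0).
have -> : x `^ (- 1 - rho) = x^-1 `^ (1 + rho).
  by rewrite -(powR_inv1 (ltW x0)) -powRrM mulN1r opprD.
by rewrite powR_le1D// lerDl ltW.
Qed.

(** Solving the pointwise tail identity for [W] (possible since [a] is nonzero) makes it a linear
    combination of integrable functions; this settles its measurability too. *)
Let integrable_W : int W.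
Proof.
have -> : W = fun w => a^-1 * (fine (G (Theta w)) - a * U w + a * b * V w).
  apply/funext => w; rewrite tail_zero_at_oo.
  by field; rewrite gt_eqF.
apply/integrableRZl/integrableRD; last exact/integrableRZl/integrable_V.
by apply/integrableRB => //; exact/integrableRZl/integrable_zero_at_oo_inv.
Qed.

Lemma probability_tail_event :
  fine (P [set w | (y (Theta w) < (Q w)%:E)%E]) =
  a * \int[P]_w U w - a * b * \int[P]_w V w + a * \int[P]_w W w.
Proof.
have /= -> := independent_xsection indQT measurable_tail_set.
have -> : (\int[P]_w P [set w' | (y (Theta w) < (Q w')%:E)%E] =
    \int[P]_w (fine (G (Theta w)))%:E)%E.
  by apply: eq_integral => w _; rewrite fineK// fin_num_measure.
rewrite -[LHS]/(\int[P]_w fine (G (Theta w))).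
under eq_Rintegral do rewrite tail_zero_at_oo.
have Ui := integrable_zero_at_oo_inv.
rewrite RintegralD//; [|apply: integrableRB|]; try exact: integrableRZl.
by rewrite RintegralB// ?RintegralZl//; exact: integrableRZl.
Qed.

(** Passes from the signed remainder in the exact formula to the absolute one controlled by the
    assumptions; positivity of the threshold lets 1/x leave the absolute value. *)
Lemma normr_Rintegral_remainder :
  `|\int[P]_w W w| <=
  fine 'E_P[fun w => (zero_at_oo (fun x => x^-1 * `|rQ x|) (y (Theta w)))%R].
Proof.
rewrite (le_trans (le_normr_Rintegral _ integrable_W))//.
rewrite unlock le_eqVlt; apply/orP; left; apply/eqP.
apply: eq_Rintegral => w _; rewrite /W; have := y_gt0 (Theta w).
case: (y (Theta w)) => //= [x|]; last by rewrite normr0.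
by rewrite lte_fin => x0; rewrite normrM gtr0_norm// invr_gt0.
Qed.

End tail_expansion.

(** * Comparison of events, measurability of the statistic, and the minimal exponent *)

(** Each of the two events is contained in the union of the other with their symmetric
    difference. *)
Lemma normrB_probability_le (d : measure_display) (Omega : measurableType d)
    (R : realType) (P : probability Omega R) (B C : set Omega) :
  measurable B -> measurable C ->
  `|fine (P B) - fine (P C)| <= fine (P (B `+` C)).
Proof.
move=> mB mC.
have mBC : measurable (B `+` C).
  by apply: measurableU; exact: measurableD.
have le X Y : measurable X -> measurable Y -> X `<=` Y `|` (B `+` C) ->
    fine (P X) <= fine (P Y) + fine (P (B `+` C)).
  move=> mX mY XY; rewrite -lee_fin EFinD !fineK ?fin_num_measure//.
  rewrite (le_trans _ (measureU2 P mY mBC))// le_measure ?inE//.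
  exact: measurableU.
rewrite ler_distl lerBlDr.
apply/andP; split; apply: le => // w Xw.
- by have [Bw|nBw] := pselect (B w); [left|right; right].
- by have [Cw|nCw] := pselect (C w); [left|right; left].
Qed.

(** [S] is measurable only on the part where its first argument is positive; since [Q] is positive
    everywhere, [(Q, Theta)] takes its values there. *)
Lemma measurable_statistic_event (R : realType)
    (d : measure_display) (Omega : measurableType d) (P : probability Omega R)
    (d' : measure_display) (T : measurableType d')
    (Q : {RV P >-> R}) (Theta : {RV P >-> T}) (S : R -> T -> R) (t : R) :
  (forall w, 0 < Q w) ->
  measurable_fun [set p : R * T | 0 < p.1] (fun p : R * T => S p.1 p.2) ->
  measurable [set w | t < S (Q w) (Theta w)].
Proof.
move=> Q0 mS; have mQT : measurable_fun setT (fun w => (Q w, Theta w)).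
  exact: measurable_fun_pair.
have mdom : measurable [set p : R * T | 0 < p.1].
  have := @measurable_fst _ _ R T measurableT _ (measurable_itv `]0, +oo[).
  rewrite setTI; congr measurable; apply/seteqP; split => p /=;
    by rewrite in_itv/= andbT.
have := measurable_comp mdom _ mS mQT.
move=> /(_ _)/(_ measurableT _ (measurable_itv `]t, +oo[)).
rewrite setTI => H.
rewrite (_ : [set _ | _] = ((fun p : R * T => S p.1 p.2) \o
    (fun w => (Q w, Theta w))) @^-1` `]t, +oo[).
  by apply: H => _ [w _ <-] /=.
by apply/seteqP; split => w /=; rewrite in_itv/= andbT.
Qed.

Lemma min_exponent_le (R : realType) (rho : R) (J : nat) (lam : 'I_J -> R) :
  min_exponent rho lam <= rho.
Proof.
rewrite /min_exponent; elim/big_rec: _ => // i x _ xrho.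
by rewrite ge_min xrho orbT.
Qed.

Lemma min_exponent_gt0 (R : realType) (rho : R) (J : nat) (lam : 'I_J -> R) :
  0 < rho -> (forall j, 0 < lam j) -> 0 < min_exponent rho lam.
Proof.
move=> rho0 lam0; rewrite /min_exponent; elim/big_rec: _ => // i x _ x0.
by rewrite lt_min lam0.
Qed.

(** * Assembly of the expansion from five negligible errors *)

Theorem mainTheorem7 (R : realType)
  (d : measure_display) (Omega : measurableType d) (P : probability Omega R)
  (d' : measure_display) (T : measurableType d')
  (Q : {RV P >-> R}) (Theta : {RV P >-> T})
  (hQ0 : forall w : Omega, 0 < Q w)
  (hind : independent_elements Q Theta)
  (a rho b : R) (ha : 0 < a) (hrho : 0 < rho)
  (rQ : R -> R)
  (hQtail : forall x : R, 0 < x ->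
     P [set w | x < Q w] = (a * x^-1 * (1 - b * x `^ (- rho) + rQ x))%:E)
  (hrQ : rQ =o_ (pinfty_nbhs R) (fun x : R => x `^ (- rho)))
  (S : R -> T -> R)
  (hSmeas : measurable_fun [set p : R * T | 0 < p.1]
              (fun p : R * T => S p.1 p.2))
  (hS0 : forall (x : R) (theta : T), 0 < x -> 0 <= S x theta)
  (J : nat) (lam : 'I_J -> R) (hlam : forall j, 0 < lam j)
  (A : T -> R) (hAmeas : measurable_fun setT A)
  (hA0 : forall theta, 0 <= A theta)
  (c : 'I_J -> T -> R) (hcmeas : forall j, measurable_fun setT (c j))
  (rS : R -> T -> R)
  (hSexp : forall theta : T, \forall x \near +oo,
     S x theta = x * A theta *
       (1 + \sum_(j < J) c j theta * x `^ (- lam j) + rS x theta))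
  (q : R -> T -> \bar R)
  (hqmeas : \forall t \near +oo, measurable_fun [set: T] (q t))
  (hqpos : \forall t \near +oo, forall theta : T, (0 < q t theta)%E)
  (hqA0 : \forall t \near +oo, forall theta : T,
     A theta = 0 -> q t theta = +oo%E)
  (hqlim : {ae P, forall w : Omega, 0 < A (Theta w) ->
     (fun t : R => q t (Theta w)) @ +oo --> +oo%E})
  (delta : R) (hdelta : delta = min_exponent rho lam)
  (htail : ereal_littleo
     (fun t => P ([set w | t < S (Q w) (Theta w)] `+`
                  [set w | (q t (Theta w) < (Q w)%:E)%E]))
     (fun t => t `^ (- 1 - delta)))
  (hq1 : ereal_littleo
     (fun t => 'E_P[fun w =>
        (`| zero_at_oo (fun x => x^-1) (q t (Theta w)) - A (Theta w) / t
           - \sum_(j < J | lam j == delta)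
               coefA Theta A (c j) (1 + delta) w * t `^ (- 1 - delta) |)%R]%E)
     (fun t => t `^ (- 1 - delta)))
  (hq2 : ereal_littleo
     (fun t => ('E_P[fun w =>
                  (zero_at_oo (fun x => x `^ (- 1 - rho)) (q t (Theta w)))%R]
                - (t `^ (- 1 - rho))%:E
                    * 'E_P[fun w => (A (Theta w) `^ (1 + rho))%R])%E)
     (fun t => t `^ (- 1 - delta)))
  (hq3 : ereal_littleo
     (fun t => 'E_P[fun w =>
        (zero_at_oo (fun x => x^-1 * `| rQ x |) (q t (Theta w)))%R]%E)
     (fun t => t `^ (- 1 - delta)))
  (* Existence of the expectations in K_delta: only needed when the minimal
     exponent occurs several times among the lam j, since for a single
     occurrence it follows from hq1 and hq2. *)
  (hint : forall i j : 'I_J, i != j -> lam i = delta -> lam j = delta ->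
     P.-integrable setT (EFin \o coefA Theta A (c i) (1 + delta))) :
  ereal_littleo
    (fun t => (P [set w | (t < S (Q w) (Theta w))%R]
               - (a%:E * 'E_P[A \o Theta] * (t^-1)%:E
                  + K_coef P Theta A c lam a b rho
                      * (t `^ (- 1 - delta))%:E))%E)
    (fun t => t `^ (- 1 - delta)).
Proof.
set o := (fun t : R => t `^ (- 1 - delta)) in htail hq1 hq2 hq3 *.
set int := (fun f : Omega -> R => P.-integrable setT (EFin \o f)).
have delta_le : delta <= rho by rewrite hdelta min_exponent_le.
have delta0 : 0 < delta by rewrite hdelta min_exponent_gt0.
have mAT s : measurable_fun setT (fun w => A (Theta w) `^ s).
  apply: (measurableT_comp (measurable_powR s)).
  exact: measurableT_comp.
have mcoef j : measurable_fun setT (coefA Theta A (c j) (1 + delta)).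
  by apply: measurable_funM => //; exact: measurableT_comp.
pose U t w := zero_at_oo (fun x => x^-1) (q t (Theta w)).
pose V t w := zero_at_oo (fun x => x `^ (- 1 - rho)) (q t (Theta w)).
pose W t w := zero_at_oo (fun x => x^-1 * rQ x) (q t (Theta w)).
pose C w := \sum_(j < J | lam j == delta) coefA Theta A (c j) (1 + delta) w.
pose D t w := U t w - A (Theta w) / t - C w * o t.
have mC : measurable_fun setT C.
  rewrite /C; under eq_fun do rewrite big_mkcond.
  by apply: measurable_sum => j; case: (lam j == delta).
have CE t w : \sum_(j < J | lam j == delta)
    coefA Theta A (c j) (1 + delta) w * t `^ (- 1 - delta) = C w * o t.
  by rewrite /C mulr_suml.
case: htail => /= htail_fin htail.
case: hq1 => /= hq1_fin hq1; case: hq2 => /= hq2_fin hq2.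
case: hq3 => /= _ hq3.
(* A finite difference of extended reals has both terms finite. As t^(-1-rho) > 0, an infinite
   expectation of A^(1+rho) would leave the product infinite. *)
have VA_fin : \forall t \near +oo, 'E_P[V t]%E \is a fin_num /\
    int (fun w => A (Theta w) `^ (1 + rho)).
  near=> t.
  have t0 : 0 < t by near: t; exact: nbhs_pinfty_gt.
  have : ('E_P[V t] - (t `^ (-1 - rho))%:E
    * 'E_P[fun w => (A (Theta w) `^ (1 + rho))%R])%E \is a fin_num.
    by near: t.
  rewrite fin_numB => /andP[Vf Af]; split => //.
  apply: fin_expectation => //; move: Af; case: ('E_P[_])%E => //=.
    by rewrite gt0_muley// lte_fin powR_gt0.
  by rewrite gt0_muleNy// lte_fin powR_gt0.
(* Integrability of A^(1+rho) does not involve t, so a single large t provides it. *)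
have [t1 [_ iArho]] := filter_ex VA_fin.
have V_fin : \forall t \near +oo, 'E_P[V t]%E \is a fin_num.
  by apply: filterS VA_fin => t [].
have iA : int (A \o Theta).
  apply: integrable_le1D iArho; first exact: measurableT_comp.
  move=> w /=; rewrite hA0/= -{1}(powRr1 (hA0 (Theta w))).
  by rewrite powR_le1D// lerDl ltW.
have iAdelta : int (fun w => A (Theta w) `^ (1 + delta)).
  apply: integrable_le1D iArho => // w.
  by rewrite powR_ge0/= powR_le1D ?lerD2l// addr_ge0// ltW.
have iU : \forall t \near +oo, int (U t).
  near=> t; have Vt : 'E_P[V t]%E \is a fin_num by near: t.
  apply: (@integrable_zero_at_oo_inv _ _ _ _ _ _ _ rho (q t)) => //.
  - by near: t.
  - by near: t.
(* Fix one large t. [D t] is integrable because [hq1] makes the expectation of its absolute value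
   finite, and [C] is recovered from [U t], A/t and [D t] on dividing by [o t > 0]. *)
have iC : int C.
  near (pinfty_nbhs R) => t.
  have t0 : 0 < t by near: t; exact: nbhs_pinfty_gt.
  have o0 : 0 < o t by exact: powR_gt0.
  have iUt : int (U t) by near: t.
  have iAt : int (fun w => A (Theta w) / t).
    by under eq_fun do rewrite mulrC; exact: integrableRZl.
  have mD : measurable_fun setT (D t).
    apply: measurable_funB; last exact: measurable_funM.
    apply/measurable_EFinP.
    exact: measurable_int (integrableRB iUt iAt).
  have iD : int (D t).
    suff /integrableP[_] : int (fun w => `|D t w|).
      move=> H; apply/integrableP; split; first exact/measurable_EFinP.
      by move: H; congr (_ < _)%E; apply: eq_integral => w _; rewrite /= normr_id.
    apply: fin_expectation; first exact: measurableT_comp.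
    rewrite [X in 'E_P[X]%E](_ : _ = fun w => `|zero_at_oo (fun x => x^-1) (q t (Theta w))
       - A (Theta w) / t - \sum_(j < J | lam j == delta)
        coefA Theta A (c j) (1 + delta) w * t `^ (- 1 - delta)|).
      by near: t.
    by apply/funext => w; rewrite CE.
  rewrite (_ : C = fun w => (o t)^-1 * (U t w - A (Theta w) / t - D t w)).
    by apply/integrableRZl/integrableRB => //; exact: integrableRB.
  by apply/funext => w; rewrite /D; field; rewrite !gt_eqF.
have icoef j : lam j == delta -> int (coefA Theta A (c j) (1 + delta)).
  move=> /eqP lamj.
  (* If another index also attains the minimum, [hint] applies; otherwise the sum [C] consists of
     the single term of index [j]. *)
  have [[i ij lami]|uniq] := pselect (exists2 i, i != j & lam i = delta).
    by apply: (hint j i) => //; rewrite eq_sym.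
  rewrite (_ : coefA _ _ _ _ = C)//; apply/funext => w.
  rewrite /C (bigD1 j) ?lamj//= big1 ?addr0// => i /andP[/eqP lami ij].
  by exfalso; apply: uniq; exists i.
pose IA := \int[P]_w A (Theta w).
pose IArho := \int[P]_w (A (Theta w) `^ (1 + rho)).
pose IAdelta := \int[P]_w (A (Theta w) `^ (1 + delta)).
pose IC := \int[P]_w C w.
pose K := a * IC - a * (rho == delta)%:R * b * IAdelta.
have KE : K_coef P Theta A c lam a b rho = K%:E.
  rewrite /K_coef -hdelta (expectation_Rintegral iAdelta).
  rewrite (eq_bigr (fun j => (\int[P]_w coefA Theta A (c j) (1 + delta) w)%:E)).
    by rewrite sumEFin -EFinM -EFinM -EFinB /K /IC /C Rintegral_sum.
  by move=> j lamj; rewrite expectation_Rintegral//; exact: icoef.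
pose p t := fine (P [set w | t < S (Q w) (Theta w)]).
have pE t : (P [set w | (t < S (Q w) (Theta w))%R]
    - (a%:E * 'E_P[A \o Theta] * (t^-1)%:E
       + K_coef P Theta A c lam a b rho * (o t)%:E))%E =
    (p t - (a * IA / t + K * o t))%:E.
  rewrite KE (expectation_Rintegral iA) -!EFinM -EFinD EFinB fineK//.
  by apply: fin_num_measure; exact: measurable_statistic_event.
split; first by near=> t; rewrite pE.
pose g t := fine (P [set w | (q t (Theta w) < (Q w)%:E)%E]).
(* The errors come from replacing the event ([e1]), q_t^-1 ([e2]) and q_t^(-1-rho) ([e3]) by their
   approximations, from the remainder of the tail of [Q] ([e4]), and from keeping the A^(1+rho) term
   only when rho = delta ([e5]). *)
pose e1 t := p t - g t.
pose e2 t := \int[P]_w D t w.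
pose e3 t := \int[P]_w V t w - t `^ (- 1 - rho) * IArho.
pose e4 t := \int[P]_w W t w.
pose e5 t := t `^ (- 1 - rho) * IArho - (rho == delta)%:R * IAdelta * o t.
have e1o : e1 =o_ (pinfty_nbhs R) o.
  apply: eqo_le htail; near=> t.
  rewrite [leRHS]ger0_norm ?fine_ge0//.
  apply: normrB_probability_le; first exact: measurable_statistic_event.
  by apply: measurable_tail_event; near: t.
have e2o : e2 =o_ (pinfty_nbhs R) o.
  apply: eqo_le hq1; near=> t.
  rewrite [leRHS]ger0_norm; last first.
    by rewrite fine_ge0// unlock integral_ge0// => w _; rewrite lee_fin.
  have iD : int (D t).
    have iUt : int (U t) by near: t.
    apply: integrableRB; last first.
      by under eq_fun do rewrite mulrC; exact: integrableRZl.
    apply: integrableRB => //.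
    by under eq_fun do rewrite mulrC; exact: integrableRZl.
  (* The absolute value of the integral is at most the integral of the absolute value, which is
     exactly the quantity in [hq1]. *)
  rewrite (le_trans (le_normr_Rintegral _ iD))//.
  rewrite unlock le_eqVlt; apply/orP; left; apply/eqP.
  by apply: eq_Rintegral => w _; rewrite CE.
have e3o : e3 =o_ (pinfty_nbhs R) o.
  apply: eqo_le hq2; near=> t.
  have Vt : 'E_P[V t]%E \is a fin_num by near: t.
  rewrite (expectation_Rintegral iArho) -EFinM fineB//.
  by rewrite unlock.
have e4o : e4 =o_ (pinfty_nbhs R) o.
  apply: eqo_le hq3; near=> t.
  rewrite [leRHS]ger0_norm; last first.
    have qt_gt0 : forall theta, (0 < q t theta)%E by near: t.
    rewrite fine_ge0// unlock integral_ge0// => w _; rewrite lee_fin.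
    have := qt_gt0 (Theta w); case: (q t (Theta w)) => //= x; rewrite lte_fin => x0.
    by rewrite mulr_ge0// invr_ge0 ltW.
  have Vt : 'E_P[V t]%E \is a fin_num by near: t.
  apply: (@normr_Rintegral_remainder _ _ _ _ _ _ Q Theta a b rho) => //.
  - by near: t.
  - by near: t.
have e5o : e5 =o_ (pinfty_nbhs R) o.
  (* If rho = delta the two terms of [e5] cancel exactly; otherwise delta < rho and t^(-1-rho) is of
     smaller order than t^(-1-delta). *)
  have [rd|rd] := eqVneq rho delta.
    rewrite (_ : e5 = fun t => 0 * o t).
      apply/eqoP => e e0; near=> t.
      by rewrite mul0r normr0 mulr_ge0// ltW.
    by apply/funext => t; rewrite /e5 /IArho rd eqxx /o mul1r mul0r mulrC subrr.
  rewrite (_ : e5 = fun t => IArho * t `^ (- 1 - rho)).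
    by apply/eqoMl/powR_eqo; rewrite ltrD2l ltrN2 lt_neqAle eq_sym rd.
  by apply/funext => t; rewrite /e5 (negbTE rd) !mul0r subr0 mulrC.
(* The total error equals e1 + a e2 - ab e3 + a e4 - ab e5: the integrals of [U] and [V] cancel
   against the exact formula for [g], leaving p minus the two main terms. *)
have := add2o (add2o (add2o (add2o e1o (eqoMl a e2o)) (eqoMl (- (a * b)) e3o))
  (eqoMl a e4o)) (eqoMl (- (a * b)) e5o).
apply: eqo_le; near=> t; rewrite pE le_eqVlt; apply/orP; left; apply/eqP.
congr `|_|; rewrite /= !fctE.
have iUt : int (U t) by near: t.
have Vt : 'E_P[V t]%E \is a fin_num by near: t.
have gE : g t = a * \int[P]_w U t w - a * b * \int[P]_w V t w + a * e4 t.
  apply: probability_tail_event => //.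
  - by near: t.
  - by near: t.
have e2E : e2 t = \int[P]_w U t w - IA / t - IC * o t.
  have iAt : int (fun w => A (Theta w) / t).
    by under eq_fun do rewrite mulrC; exact: integrableRZl.
  have iCt : int (fun w => C w * o t).
    by under eq_fun do rewrite mulrC; exact: integrableRZl.
  by rewrite /e2 /D RintegralB// ?RintegralB// ?RintegralZr//; exact: integrableRB.
rewrite e2E /e1 gE /e3 /e5 /K; ring.
Unshelve. all: by end_near. Qed.
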